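(* Let $H$ be a Hilbert space and let $E,A\in L(H)$ be bounded linear operators such that the pair $(E,A)$ is regular. Assume that $E[\mathrm{IV}_{j}]\subseteq H$ is closed for each $j\in\mathbb{N}$, and let $u_0\in H$. Then there exists a continuously differentiable function $u\colon\mathbb{R}_{>0}\to H$ with $u(0+)=u_0$ and $$Eu'(t)+Au(t)=0\quad(t>0)$$ if, and only if, $u_0\in\mathrm{IV}_{\operatorname{ind}(E,A)+1}$.
   Context: $H$ is a complex Hilbert space (possibly infinite-dimensional), $L(H)$ is the space of bounded linear operators on $H$, and $\mathbb{N}$ contains $0$. For $\nu_0\in\mathbb{R}$, $\mathbb{C}_{\operatorname{Re}>\nu_0}=\{s\in\mathbb{C}: \operatorname{Re}s>\nu_0\}$. For $E,A\in L(H)$ put $\rho(E,A)=\{s\in\mathbb{C}: (sE+A)^{-1}\in L(H)\}$. The pair $(E,A)$ is called regular if there is $\nu_0\in\mathbb{R}$ with $\mathbb{C}_{\operatorname{Re}>\nu_0}\subseteq\rho(E,A)$ and there exist $C\geq 0$, $k\in\mathbb{N}$ such that $\|(sE+A)^{-1}\|\leq C|s|^{k}$ for all $s\in\mathbb{C}_{\operatorname{Re}>\nu_0}$. With such a $\nu_0$ fixed, the index is $$\operatorname{ind}(E,A)=\min\{k\in\mathbb{N}: \exists C\geq 0\ \forall s\in\mathbb{C}_{\operatorname{Re}>\nu_0}:\ \|(sE+A)^{-1}\|\leq C|s|^{k}\}.$$ The initial value spaces are defined by $\mathrm{IV}_0=H$ and $\mathrm{IV}_{j+1}=\{x\in H: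 Ax\in E[\mathrm{IV}_j]\}$ for $j\in\mathbb{N}$, where $E[V]=\{Ev: v\in V\}$. The notation $u(0+)=u_0$ means that $\lim_{t\to 0+}u(t)=u_0$ in $H$. *)

(* Defs.v *)
From HB Require Import structures.
From mathcomp Require Import all_boot all_order all_algebra.
From mathcomp Require Import sesquilinear complex.
From mathcomp Require Import all_classical all_reals all_analysis.
Import Order.TTheory GRing.Theory Num.Theory.
Import numFieldNormedType.Exports.

Set Implicit Arguments.
Unset Strict Implicit.
Unset Printing Implicit Defensive.

Local Open Scope classical_set_scope.
Local Open Scope ring_scope.
Local Open Scope complex_scope.

(* The form [inner] is positive definite and Hermitian, linear on the left and
   conjugate-linear on the right. *)
HB.mixin Record CompleteNormedModule_isHilbert (R : realType) H
    of CompleteNormedModule R[i] H := {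
  inner : {dot H for (@Num.conj R[i])} ;
  inner_norm : forall x : H, inner x x = `|x| ^+ 2
}.

#[short(type="hilbertType")]
HB.structure Definition Hilbert (R : realType) :=
  { H of CompleteNormedModule R[i] H & CompleteNormedModule_isHilbert R H }.

(* Norms over [R[i]] take their (real) values in [R[i]]. *)
Definition rnorm (R : realType) (V : normedZmodType R[i]) (x : V) : R :=
  complex.Re `|x|.

Section BoundedOperators.
Context {R : realType} {H : hilbertType R}.

Definition bounded_op (T : H -> H) : Prop :=
  exists M : R, forall x, rnorm (T x) <= M * rnorm x.

Definition opnorm (T : H -> H) : R :=
  sup [set rnorm (T x) | x in [set x : H | rnorm x <= 1]].

Definition bounded_inverse (T S : H -> H) : Prop :=
  [/\ linear S, bounded_op S, cancel T S & cancel S T].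

End BoundedOperators.

Section Pencils.
Context {R : realType} {H : hilbertType R} (E A : H -> H).

Definition pencil (s : R[i]) : H -> H := fun x => s *: E x + A x.

Definition rho : set R[i] :=
  [set s | exists S, bounded_inverse (pencil s) S].

(* [(sE + A)^-1] for [s] in [rho], and the junk value [0] elsewhere. *)
Definition resolvent (s : R[i]) : H -> H :=
  xget (fun=> 0) [set S | bounded_inverse (pencil s) S].

Definition resolvent_bound (nu0 : R) (k : nat) : Prop :=
  exists2 C : R, 0 <= C & forall s : R[i], nu0 < complex.Re s ->
    opnorm (resolvent s) <= C * rnorm s ^+ k.

(* [(E, A)] is regular iff it is [regular_at nu0] for some [nu0]. *)
Definition regular_at (nu0 : R) : Prop :=
  [set s | nu0 < complex.Re s] `<=` rho /\ exists k, resolvent_bound nu0 k.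

Definition ind (nu0 : R) : nat :=
  xget 0%N [set k | resolvent_bound nu0 k /\
                    forall j, resolvent_bound nu0 j -> (k <= j)%N].

Fixpoint IV (j : nat) : set H :=
  if j is j'.+1 then [set x | (E @` IV j') (A x)] else setT.

End Pencils.

Section Solutions.
Context {R : realType} {H : hilbertType R}.

(* The library's [derive] needs a function between modules over the same field;
   here the variable is real and the values lie in a complex space. *)
Definition has_derivative (u : R -> H) (t : R) (v : H) : Prop :=
  (fun h : R => (h^-1)%:C *: (u (t + h) - u t)) @ 0^' --> v.

(* Functions on the positive reals are represented by total functions on [R],
   of which only the values at [t > 0] matter. *)
Definition C1_with_derivative (u u' : R -> H) : Prop :=
  forall t : R, 0 < t -> has_derivative u t (u' t) /\ {for t, continuous u'}.

Definition solution (E A : H -> H) (u0 : H) (u : R -> H) : Prop :=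
  exists u' : R -> H,
    [/\ C1_with_derivative u u',
        u t @[t --> 0^'+] --> u0 &
        forall t : R, 0 < t -> E (u' t) + A (u t) = 0].

End Solutions.

(* Main.v *)
Require Import Defs.
From HB Require Import structures.
From mathcomp Require Import all_boot all_order all_algebra.
From mathcomp Require Import sesquilinear complex.
From mathcomp Require Import all_classical all_reals all_analysis.
From mathcomp Require Import ring lra.
Import Order.TTheory GRing.Theory Num.Theory.
Import numFieldNormedType.Exports.

Set Implicit Arguments.
Unset Strict Implicit.
Unset Printing Implicit Defensive.

Local Open Scope classical_set_scope.
Local Open Scope ring_scope.
Local Open Scope complex_scope.

(** Write [R(s)] for [(sE + A)^-1] and [k] for the index.

    If [u] is a solution, then [A u(t) = - E u'(t)], so [u(t)] lies in [IV_1];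
    the spaces [IV_j] are closed subspaces, being preimages under [A] of the
    closed spaces [E[IV_j]], so the derivative [u'(t)] lies in [IV_1] too, and
    the equation then puts [u(t)] in [IV_2].  By induction [u(t)] lies in every
    [IV_j], and so does the limit [u_0] ([solution_IV]).

    For the converse, [s] tends to infinity along the reals.  If [A x = E x_1]
    then [R(s)Ax = (x_1 - R(s)A x_1) / s]: each step into the chain of initial
    value spaces gains a factor [1/s] over the growth [s^k] of the resolvent.
    Hence [R(s)Ax] is bounded for [x] in [IV_k] and [O(1/s)] for [x] in
    [IV_{k+1}] ([IV_resolvent_growth]).  Since [s R(s)Ex = x - R(s)Ax] and
    [R(s)E] maps [IV_j] into [IV_{j+1}], this has two consequences.

    - For [x] in [IV_k], [E(s R(s)Ex)] tends to [Ex] and lies in the closed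
      space [E[IV_{k+1}]], so that [E[IV_k] = E[IV_{k+1}]] ([image_IV_stable]).

    - For [x] in [IV_{k+1}], [s R(s)Ex] tends to [x].  The operators [s R(s)]
      are therefore pointwise bounded on the closed space [E[IV_{k+1}]]; by the
      uniform boundedness principle they are uniformly bounded there, and the
      limit gives [|x| <= c |Ex|] on [IV_{k+1}] ([E_bounded_below]).

    Thus [B = E^-1 A] is a well defined bounded operator on [IV_{k+1}], and
    [u(t) = exp(-tB) u_0], a power series with coefficients [(-B)^i u_0], is
    a solution ([IVk1_solution]). *)

(** * Linear maps given as bare functions *)

Section LinearFunctions.
Context {K : pzRingType} {V W : lmodType K} (T : V -> W) (linT : linear T).

Lemma linear_funD y z : T (y + z) = T y + T z.
Proof. by rewrite -[y]scale1r linT !scale1r. Qed.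

Lemma linear_fun0 : T 0 = 0.
Proof. by apply: (addrI (T 0)); rewrite -linear_funD !addr0. Qed.

Lemma linear_funZ a y : T (a *: y) = a *: T y.
Proof. by rewrite -[a *: y]addr0 linT linear_fun0 addr0. Qed.

Lemma linear_funB y z : T (y - z) = T y - T z.
Proof. by rewrite linear_funD -scaleN1r linear_funZ scaleN1r. Qed.

End LinearFunctions.

(** * The real-valued norm and its topology *)

Section RealNorm.
Context {R : realType}.

Section Normed.
Context {V : normedModType R[i]}.
Implicit Types x y : V.

Lemma rnormE x : `|x| = (rnorm x)%:C.
Proof. by rewrite /rnorm RRe_real// normr_real. Qed.

Lemma rnorm_ge0 x : 0 <= rnorm x.
Proof. by rewrite -ler0c -rnormE. Qed.

Lemma rnorm0 : rnorm (0 : V) = 0.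
Proof. by rewrite /rnorm normr0. Qed.

Lemma rnormN x : rnorm (- x) = rnorm x.
Proof. by rewrite /rnorm normrN. Qed.

Lemma rnorm_distC x y : rnorm (x - y) = rnorm (y - x).
Proof. by rewrite -rnormN opprB. Qed.

Lemma ler_rnormD x y : rnorm (x + y) <= rnorm x + rnorm y.
Proof. by rewrite -lecR rmorphD /= -!rnormE ler_normD. Qed.

Lemma ler_rnormB x y : rnorm (x - y) <= rnorm x + rnorm y.
Proof. by rewrite -(rnormN y) ler_rnormD. Qed.

Lemma ler_rnorm_dist x y z : rnorm (x - z) <= rnorm (x - y) + rnorm (y - z).
Proof. by rewrite -[x in leLHS](subrK y) -addrA ler_rnormD. Qed.

Lemma rnormZ (r : R) x : rnorm (r%:C *: x) = `|r| * rnorm x.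
Proof.
apply: complexI.
by rewrite rmorphM /= -!rnormE normrZ normc_def /= expr0n addr0 sqrtr_sqr.
Qed.

Lemma cvg_rnormP {T} {F : set_system T} {FF : Filter F} (f : T -> V) y :
  f @ F --> y <->
  forall e : R, 0 < e -> \forall t \near F, rnorm (y - f t) < e.
Proof.
split=> [/cvgrPdist_lt cf e e0|cf].
  have := cf e%:C; rewrite ltcR => /(_ e0).
  by apply: filterS => t; rewrite rnormE ltcR.
apply/cvgrPdist_lt => e; rewrite ltcE /= => /andP[/eqP ime e0].
have := cf _ e0; apply: filterS => t.
by rewrite rnormE ltcE /= eq_sym ime eqxx.
Qed.

Lemma cvg_rnorm_le {F : set_system nat} {FF : ProperFilter F} (f : nat -> V) y z K :
  f @ F --> y -> (\forall n \near F, rnorm (f n - z) <= K) -> rnorm (y - z) <= K.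
Proof.
move=> /cvg_rnormP fy fK; apply/ler_addgt0Pr => e e0.
have [n [fnK fny]] := filter_ex (filterI fK (fy _ e0)).
by rewrite [leRHS]addrC; apply: le_trans (ler_rnorm_dist _ (f n) _) _; rewrite lerD// ltW.
Qed.

End Normed.

Lemma cauchy_rnorm_cvg {V : completeNormedModType R[i]} (u : nat -> V) :
  (forall e : R, 0 < e -> exists N, forall n, (N <= n)%N -> rnorm (u N - u n) < e) ->
  cvgn u.
Proof.
move=> cu; apply/cauchy_cvgP/cauchy_exP => e; rewrite ltcE /= => /andP[/eqP ime e0].
have [N uN] := cu _ e0; exists (u N) => //; exists N => // n Nn.
rewrite -ball_normE /ball_ /= rnormE ltcE /= eq_sym ime eqxx.
exact: uN.
Qed.

End RealNorm.

(** * Uniform boundedness on a closed subspace *)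

Section UniformBoundedness.
Context {R : realType} {V : completeNormedModType R[i]} {W : normedModType R[i]}.
Context (Y : set V) (T : nat -> V -> W).
Context (clY : closed Y) (Y0 : Y 0)
  (linY : forall a x y, Y x -> Y y -> Y (a *: x + y)).
Context (linT : forall n, linear (T n))
  (bdT : forall n, exists M : R, forall x, rnorm (T n x) <= M * rnorm x).

(** One step of the nested ball argument.  Without a uniform bound, some [T n] is
    huge on arbitrarily short vectors of [Y]; adding or subtracting one of them
    moves [x] slightly to a point where [T n] is large, and by continuity [T n]
    stays large on a small ball. *)
Lemma escape_ball (K r : R) (x : V) :
  ~ (exists M : R, forall n y, Y y -> rnorm (T n y) <= M * rnorm y) ->
  0 <= K -> Y x -> 0 < r ->
  exists x' : V, exists r' : R,
    [/\ Y x', rnorm (x' - x) <= r / 2, 0 < r', r' <= r / 2 &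
        exists n, forall z, rnorm (z - x') <= r' -> K <= rnorm (T n z)].
Proof.
move=> nbd K0 Yx r0.
have YB y z : Y y -> Y z -> Y (y - z).
  by move=> Yy Yz; rewrite addrC -scaleN1r; exact: linY.
have [n [y [Yy Tny]]] : exists n y, Y y /\ (K + 1) * 2 / r * rnorm y < rnorm (T n y).
  apply: contrapT => H; apply: nbd; exists ((K + 1) * 2 / r) => n y Yy.
  by rewrite leNgt; apply/negP => lt; apply: H; exists n, y.
have y0 : 0 < rnorm y.
  rewrite lt_def rnorm_ge0 andbT; apply/eqP => ny0.
  have y_eq0 : y = 0 by apply/eqP; rewrite -normr_eq0 rnormE ny0.
  by move: Tny; rewrite y_eq0 linear_fun0// !rnorm0 mulr0 ltxx.
pose y' := (r / 2 / rnorm y)%:C *: y.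
have c0 : 0 < r / 2 / rnorm y by rewrite !divr_gt0.
have ny' : rnorm y' = r / 2.
  by rewrite rnormZ gtr0_norm// divfK ?gt_eqF.
have Yy' : Y y' by rewrite -[y']addr0; exact: linY.
have Ty' : K + 1 < rnorm (T n y').
  rewrite linear_funZ// rnormZ gtr0_norm//; move: Tny; rewrite -(ltr_pM2l c0).
  rewrite [X in X < _](_ : _ = K + 1)//; field.
  by rewrite !gt_eqF.
(* [T y'] is half the difference of [T (x + y')] and [T (x - y')], so one of
   these two is at least as large as [T y']. *)
have [x' [Yx' xx' Tx']] :
    exists x', [/\ Y x', rnorm (x' - x) <= r / 2 & K + 1 < rnorm (T n x')].
  have [lt|ge] := ltP (K + 1) (rnorm (T n (x + y'))).
    exists (x + y'); split => //; last by rewrite addrC addKr ny'.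
    by rewrite -[x]scale1r; exact: linY.
  exists (x - y'); split; first exact: YB.
    by rewrite addrC addKr rnormN ny'.
  have := ler_rnormB (T n (x + y')) (T n (x - y')).
  rewrite -linear_funB// opprB [x + y']addrC addrACA subrr addr0 -mulr2n -scaler_nat linear_funZ//.
  have -> : 2%:R = (2 : R)%:C by rewrite rmorph_nat.
  rewrite rnormZ ger0_norm//; move: ge; rewrite [x + y']addrC; lra.
have [M TM] := bdT n.
(* [T n] moves by at most [1] over the distance [M'^-1], which costs the [+ 1] in
   the choice of [y]. *)
pose M' := `|M| + 1.
have M'0 : 0 < M' by rewrite ltr_wpDl.
exists x', (Num.min (r / 2) M'^-1); split => //.
- by rewrite lt_min divr_gt0 ?invr_gt0.
- by rewrite ge_min lexx.
exists n => z; rewrite le_min => /andP[_ zx'].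
have : rnorm (T n (z - x')) <= 1.
  apply: (le_trans (TM _)); apply: (@le_trans _ _ (M' * rnorm (z - x'))).
    by rewrite ler_wpM2r ?rnorm_ge0// (le_trans (ler_norm _))// lerDl.
  by rewrite -ler_pdivlMl// mulr1.
rewrite linear_funB// => Tzx.
have := ler_rnormB (T n z) (T n z - T n x'); rewrite opprB addrC subrK; lra.
Qed.

(** The centres of the nested balls stay in the closed set [Y], so their limit is a
    point of [Y] at which the family [T] is unbounded. *)
Lemma uniform_boundedness :
  (forall y, Y y -> exists M : R, forall n, rnorm (T n y) <= M) ->
  exists M : R, forall n y, Y y -> rnorm (T n y) <= M * rnorm y.
Proof.
move=> ptw; apply: contrapT => nbd.
(* A state is a counter with the centre and the radius of a ball. *)
pose shrink (s s' : nat * (V * R)) := Y s.2.1 -> 0 < s.2.2 ->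
  [/\ s'.1 = s.1.+1, Y s'.2.1, 0 < s'.2.2,
      rnorm (s'.2.1 - s.2.1) <= s.2.2 / 2 /\ s'.2.2 <= s.2.2 / 2 &
      exists n, forall z, rnorm (z - s'.2.1) <= s'.2.2 -> s.1%:R <= rnorm (T n z)].
have [|s [s0 sshrink]] := @dependent_choice _ shrink _ (0%N, (0 : V, 1 : R)).
  move=> [i [x r]]; apply: cid.
  have [[/= Yx r0]|nYr] := pselect (Y x /\ 0 < r); last first.
    by exists (0%N, (0, 1)) => /= Yx r0; case: nYr.
  have [x' [r' [Yx' xx' r'0 rr' nz]]] := escape_ball nbd (ler0n R i) Yx r0.
  by exists (i.+1, (x', r')).
pose x n := (s n).2.1; pose r n := (s n).2.2.
have inv n : [/\ (s n).1 = n, Y (x n), 0 < r n & r n * n.+1%:R <= 1].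
  elim: n => [|n [sn Yxn rn0 rn]]; rewrite /x /r; first by rewrite s0 /= mul1r.
  have [sn1 Yx' r'0 [_ r'] _] := sshrink n Yxn rn0.
  split=> //; first by rewrite sn1 sn.
  rewrite (le_trans (ler_wpM2r _ r'))// (le_trans _ rn)// -mulrA ler_pM2l//.
  by rewrite ler_pdivrMl// -natrM ler_nat mul2n -addnn addSn ltnS leq_addl.
have step n : rnorm (x n.+1 - x n) <= r n / 2 /\ r n.+1 <= r n / 2.
  by have [_ Yn rn _] := inv n; have [_ _ _ []] := sshrink n Yn rn.
have tail n j : rnorm (x (n + j)%N - x n) + r (n + j)%N <= r n.
  elim: j => [|j IH]; first by rewrite addn0 subrr rnorm0 add0r.
  rewrite addnS (le_trans _ IH)//.
  have [xx rr] := step (n + j)%N.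
  have := ler_rnorm_dist (x (n + j).+1) (x (n + j)%N) (x n); lra.
have near_x n m : (n <= m)%N -> rnorm (x m - x n) <= r n.
  move=> nm; have := tail n (m - n)%N; rewrite subnKC//.
  by have [_ _ rm0 _] := inv m; lra.
have cx : cvgn x.
  apply: cauchy_rnorm_cvg => e e0; exists (Num.truncn e^-1) => n Nn.
  rewrite rnorm_distC (le_lt_trans (near_x _ _ Nn))//.
  have [_ _ rN rN1] := inv (Num.truncn e^-1).
  have := truncnS_gt e^-1; rewrite -(ltr_pM2l e0) mulfV ?gt_eqF// => lt.
  by have := le_lt_trans rN1 lt; rewrite ltr_pM2r.
have near_lim n : rnorm (limn x - x n) <= r n.
  apply: cvg_rnorm_le cx _; exists n => // m /= nm; exact: near_x.
have Yl : Y (limn x).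
  by apply: (closed_cvg (u_ := x) Y clY _ _ cx); apply: nearW => n; have [] := inv n.
have [M TM] := ptw _ Yl.
pose n := (Num.truncn M).+1.
have [sn Yn rn _] := inv n.
have [_ _ _ _ [m Tm]] := sshrink n Yn rn.
have := Tm _ (near_lim n.+1); rewrite sn => /le_trans/(_ (TM m)).
by rewrite leNgt /n truncnS_gt.
Qed.

End UniformBoundedness.

(** * Exponential series with vector coefficients *)

(** Second order Taylor estimate of a monomial.  The constant is crude, but it is
    geometric in the exponent, so that the estimates can be summed against
    [1 / i!]. *)
Lemma taylor2_exprn {R : realType} (t h : R) (j : nat) : `|h| <= 1 ->
  `|(t + h) ^+ j.+1 - t ^+ j.+1 - j.+1%:R * h * t ^+ j|
    <= h ^+ 2 * (2 + `|t|) ^+ j.+1.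
Proof.
move=> h1.
have t0 : 0 <= `|t| := normr_ge0 t.
have mul_exp i : i%:R * `|t| ^+ i.-1 <= (1 + `|t|) ^+ i.
  elim: i => [|i IH]; first by rewrite mul0r expr0 ler01.
  have -> : i.+1%:R * `|t| ^+ i.+1.-1 = `|t| * (i%:R * `|t| ^+ i.-1) + `|t| ^+ i.
    case: i {IH} => [|i] /=; first by rewrite !mul0r mulr0 add0r mul1r.
    by rewrite [in LHS]mulrSr exprS; ring.
  rewrite exprS mulrDl mul1r addrC lerD ?ler_wpM2l//.
  by rewrite lerXn2r ?nnegrE//; lra.
elim: j => [|j IH].
  rewrite !expr1 expr0 mulr1 mul1r [t + h]addrC addrK subrr normr0.
  by rewrite mulr_ge0 ?sqr_ge0//; lra.
have -> : (t + h) ^+ j.+2 - t ^+ j.+2 - j.+2%:R * h * t ^+ j.+1 =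
    (t + h) * ((t + h) ^+ j.+1 - t ^+ j.+1 - j.+1%:R * h * t ^+ j)
    + h ^+ 2 * (j.+1%:R * t ^+ j).
  by rewrite [j.+2%:R]mulrSr !exprS; ring.
rewrite (le_trans (ler_normD _ _))// [(2 + `|t|) ^+ j.+2]exprS.
have -> : h ^+ 2 * ((2 + `|t|) * (2 + `|t|) ^+ j.+1) =
  (1 + `|t|) * (h ^+ 2 * (2 + `|t|) ^+ j.+1) + h ^+ 2 * (2 + `|t|) ^+ j.+1 by ring.
rewrite lerD//.
  rewrite normrM ler_pM//; have := ler_normD t h; lra.
rewrite normrM ger0_norm ?sqr_ge0// ler_wpM2l ?sqr_ge0//.
rewrite normrM normr_nat normrX (le_trans (mul_exp j.+1))//.
by rewrite lerXn2r ?nnegrE//; lra.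
Qed.

Lemma expR_partial_le {R : realType} (c : R) n : 0 <= c ->
  \sum_(i < n) c ^+ i / i`!%:R <= expR c.
Proof.
move=> c0; rewrite -(big_mkord xpredT (fun i => c ^+ i / i`!%:R)).
apply: (@nondecreasing_cvgn_le _ (series (exp_coeff c))).
  by apply/nondecreasing_seqP => m; rewrite seriesSr lerDl exp_coeff_ge0.
exact: is_cvg_series_exp_coeff.
Qed.

Section ExponentialSeries.
Context {R : realType} {V : completeNormedModType R[i]}.
Implicit Types (v : nat -> V) (t M b : R).

Definition expseries v t : nat -> V :=
  fun n => \sum_(i < n) (t ^+ i / i`!%:R)%:C *: v i.

Definition expsum v t : V := limn (expseries v t).

Lemma expseriesS v t n :
  expseries v t n.+1 = expseries v t n + (t ^+ n / n`!%:R)%:C *: v n.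
Proof. by rewrite /expseries big_ord_recr. Qed.

Definition geom_growth v M b :=
  [/\ 0 <= M, 0 <= b & forall i, rnorm (v i) <= M * b ^+ i].

Lemma geom_growth_shift v M b :
  geom_growth v M b -> geom_growth (v \o S) (M * b) b.
Proof.
case=> M0 b0 vb; split => [||i] //; first exact: mulr_ge0.
by rewrite -mulrA -exprS; exact: vb.
Qed.

Lemma expseries_cvg v t M b :
  geom_growth v M b -> expseries v t @ \oo --> expsum v t.
Proof.
case=> M0 b0 vb; apply: cauchy_rnorm_cvg => e e0.
set c := `|t| * b.
have e'0 : 0 < e / (M + 1) / 2 by rewrite !divr_gt0// ltr_wpDl.
have /cvgrPdist_lt/(_ _ e'0)[N _ HN] := @is_cvg_series_exp_coeff _ c.
have dist n : rnorm (expseries v t (N + n) - expseries v t N) <=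
    M * (series (exp_coeff c) (N + n)%N - series (exp_coeff c) N).
  elim: n => [|n IH]; first by rewrite addn0 !subrr rnorm0 mulr0.
  rewrite addnS expseriesS addrAC (le_trans (ler_rnormD _ _))//.
  rewrite [series _ (_.+1)]seriesSr addrAC mulrDr lerD// rnormZ.
  rewrite normrM normfV normrX normr_nat /exp_coeff /= exprMn.
  rewrite [leRHS](_ : _ = `|t| ^+ (N + n) / (N + n)`!%:R * (M * b ^+ (N + n))); last by ring.
  by rewrite ler_wpM2l// divr_ge0.
exists N => n Nn; rewrite rnorm_distC; have := dist (n - N)%N; rewrite subnKC//.
move=> /le_lt_trans; apply.
have dS : series (exp_coeff c) n - series (exp_coeff c) N < e / (M + 1).
  have := HN n Nn; have := HN N (leqnn N) => /=.
  by rewrite !ltr_norml => /andP[? ?] /andP[? ?]; lra.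
apply: (@le_lt_trans _ _ (M * (e / (M + 1)))); first by rewrite ler_wpM2l// ltW.
rewrite mulrCA gtr_pMr// ltr_pdivrMr ?mul1r ?ltrDl//.
by rewrite ltr_wpDl.
Qed.

Lemma expsum0 v : expsum v 0 = v 0%N.
Proof.
apply/cvg_lim => //; apply: cvg_near_cst; exists 1%N => // -[//|n] _.
rewrite /expseries big_ord_recl big1 ?addr0 ?expr0 ?fact0 ?divr1 ?scale1r// => i _.
by rewrite exprS !mul0r scale0r.
Qed.

(** Shifting the coefficients differentiates the exponential series.  The estimate
    is proved for the partial sums, those of the shifted series having one term
    less, with a constant that does not depend on their length. *)
Lemma expsum_taylor2 v t M b : geom_growth v M b ->
  exists K : R, forall h : R, `|h| <= 1 ->
    rnorm (expsum v (t + h) - expsum v t - h%:C *: expsum (v \o S) t) <= K * h ^+ 2.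
Proof.
move=> gv; have [M0 b0 vb] := gv.
exists (M * expR ((2 + `|t|) * b)) => h h1.
have c0 : 0 <= (2 + `|t|) * b by rewrite mulr_ge0// addr_ge0.
pose D n := expseries v (t + h) n.+1 - expseries v t n.+1
  - h%:C *: expseries (v \o S) t n.
have cD : D @ \oo --> expsum v (t + h) - expsum v t - h%:C *: expsum (v \o S) t.
  apply: cvgB; last exact: (cvgZl_tmp (k := h%:C) (expseries_cvg (geom_growth_shift gv))).
  apply: cvgB; rewrite (cvg_shiftS (expseries v _)); exact: expseries_cvg gv.
rewrite -[X in rnorm X]subr0; apply: cvg_rnorm_le cD _; apply: nearW => n.
rewrite subr0 mulrAC.
have DK : rnorm (D n) <=
    M * h ^+ 2 * \sum_(i < n.+1) ((2 + `|t|) * b) ^+ i / i`!%:R.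
  elim: n => [|n IH].
    rewrite /D /expseries !big_ord_recl !big_ord0 scaler0 !expr0 subrr subr0 rnorm0.
    by rewrite addr0 fact0 divr1 mulr1 mulr_ge0 ?sqr_ge0.
  pose q := ((t + h) ^+ n.+1 - t ^+ n.+1 - n.+1%:R * h * t ^+ n) / n.+1`!%:R.
  have -> : D n.+1 = D n + q%:C *: v n.+1.
    rewrite /D [expseries v (t + h) n.+2]expseriesS [expseries v t n.+2]expseriesS.
    rewrite [expseries (v \o S) t n.+1]expseriesS.
    have -> : q%:C *: v n.+1 = ((t + h) ^+ n.+1 / n.+1`!%:R)%:C *: v n.+1
       - (t ^+ n.+1 / n.+1`!%:R)%:C *: v n.+1
       - h%:C *: ((t ^+ n / n`!%:R)%:C *: v n.+1).
      rewrite scalerA -!scalerBl -rmorphM -!rmorphB /=; congr (_%:C *: _).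
      rewrite /q factS natrM; field.
      by rewrite nat1r !pnatr_eq0 -lt0n fact_gt0.
    by rewrite scalerDr !opprD (addrACA (expseries v (t + h) n.+1)) [LHS]addrACA.
  rewrite big_ord_recr mulrDr (le_trans (ler_rnormD _ _))// lerD// rnormZ.
  rewrite /q normrM normfV normr_nat exprMn.
  rewrite [leRHS](_ : _ = (h ^+ 2 * (2 + `|t|) ^+ n.+1 / n.+1`!%:R)
    * (M * b ^+ n.+1)); last by rewrite /=; ring.
  rewrite ler_pM ?rnorm_ge0 ?divr_ge0//.
  by rewrite ler_wpM2r ?invr_ge0// taylor2_exprn.
rewrite (le_trans DK)// ler_wpM2l ?expR_partial_le//.
by rewrite mulr_ge0 ?sqr_ge0.
Qed.

Lemma taylor2_continuous (u : R -> V) (w : V) (t K : R) :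
  (forall h : R, `|h| <= 1 -> rnorm (u (t + h) - u t - h%:C *: w) <= K * h ^+ 2) ->
  {for t, continuous u}.
Proof.
move=> uK; apply/cvg_rnormP => e e0.
have L0 : 0 < `|K| + rnorm w + 1 by rewrite ltr_wpDl ?addr_ge0 ?rnorm_ge0.
have : 0 < Num.min 1 (e / (`|K| + rnorm w + 1)) by rewrite lt_min ltr01 divr_gt0.
have /cvgrPdist_lt tt : s @[s --> t] --> t by exact: cvg_id.
move=> /tt; apply: filterS => s.
rewrite lt_min ltr_pdivlMr// distrC => /andP[h1 he].
rewrite rnorm_distC; have := uK (s - t) (ltW h1); rewrite [t + _]addrC subrK => uKs.
apply: le_lt_trans he.
have -> : u s - u t = (u s - u t - (s - t)%:C *: w) + (s - t)%:C *: w by rewrite subrK.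
rewrite (le_trans (ler_rnormD _ _))// rnormZ !mulrDr mulr1.
have K2 : K * (s - t) ^+ 2 <= `|s - t| * `|K|.
  rewrite -real_normK ?num_real// mulrC expr2 -mulrA ler_wpM2l//.
  rewrite (le_trans (ler_wpM2l _ (ler_norm K)))//.
  by rewrite -[leRHS]mul1r ler_wpM2r// ltW.
by move: uKs K2 (normr_ge0 (s - t)); lra.
Qed.

End ExponentialSeries.

(** * Bounded operators and derivatives *)

Section OperatorsOnHilbert.
Context {R : realType} {H : hilbertType R}.
Implicit Types (T : H -> H) (u : R -> H).

Lemma bounded_op_pos T : bounded_op T ->
  exists2 M : R, 0 < M & forall x, rnorm (T x) <= M * rnorm x.
Proof.
case=> M TM; exists (`|M| + 1) => [|x]; first by rewrite ltr_wpDl.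
by rewrite (le_trans (TM x))// ler_wpM2r ?rnorm_ge0// (le_trans (ler_norm _))// lerDl.
Qed.

Lemma bounded_op_cvg (T : {linear H -> H}) {I} {F : set_system I} {FF : Filter F}
    (f : I -> H) y :
  bounded_op T -> f @ F --> y -> T (f i) @[i --> F] --> T y.
Proof.
move=> /bounded_op_pos[M M0 TM] /cvg_rnormP fy; apply/cvg_rnormP => e e0.
have := fy (e / M); rewrite divr_gt0// => /(_ isT); apply: filterS => i.
rewrite ltr_pdivlMr// mulrC => /(le_lt_trans _); apply.
by rewrite -linearB.
Qed.

Lemma rnorm_opnorm (T : H -> H) x : linear T -> bounded_op T ->
  rnorm (T x) <= opnorm T * rnorm x.
Proof.
move=> linT /bounded_op_pos[M M0 TM].
have [x0|x0] := eqVneq (rnorm x) 0.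
  have -> : x = 0 by apply/eqP; rewrite -normr_eq0 rnormE x0.
  by rewrite linear_fun0// !rnorm0 mulr0.
have xp : 0 < rnorm x by rewrite lt_def x0 rnorm_ge0.
rewrite -ler_pdivrMr// mulrC -[X in X * _]gtr0_norm ?invr_gt0// -rnormZ -linear_funZ//.
apply: ub_le_sup.
  exists M => _ [y y1 <-]; rewrite (le_trans (TM y))//.
  by rewrite -[leRHS]mulr1 ler_wpM2l// ltW.
exists ((rnorm x)^-1%:C *: x) => //=.
by rewrite rnormZ gtr0_norm ?invr_gt0// mulVf.
Qed.

Lemma taylor2_has_derivative u (w : H) (t K : R) :
  (forall h : R, `|h| <= 1 -> rnorm (u (t + h) - u t - h%:C *: w) <= K * h ^+ 2) ->
  has_derivative u t w.
Proof.
move=> uK; apply/cvg_rnormP => e e0.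
have K0 : 0 < `|K| + 1 by rewrite ltr_wpDl.
near=> h.
have h0 : h != 0 by near: h; exact: nbhs_dnbhs_neq.
have h1 : `|h| <= 1 by near: h; apply: dnbhs0_le.
have he : `|h| < e / (`|K| + 1) by near: h; apply: dnbhs0_lt; rewrite divr_gt0.
have -> : w - h^-1%:C *: (u (t + h) - u t) =
    h^-1%:C *: - (u (t + h) - u t - h%:C *: w).
  by rewrite opprB [RHS]scalerBr scalerA -rmorphM /= mulVf// scale1r.
rewrite rnormZ rnormN normfV.
rewrite ltr_pdivrMl ?normr_gt0// (le_lt_trans (uK h h1))//.
move: he; rewrite ltr_pdivlMr// => he.
rewrite -real_normK ?num_real// expr2 mulrCA ltr_pM2l ?normr_gt0//.
apply: le_lt_trans he; rewrite mulrC ler_wpM2l//.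
by rewrite (le_trans (ler_norm _))// lerDl.
Unshelve. all: by end_near.
Qed.

End OperatorsOnHilbert.

(** * Initial value spaces *)

Section InitialValueSpaces.
Context {R : realType} {H : hilbertType R} (E A : {linear H -> H}).
Local Notation IV := (IV E A).

Lemma IV_linear j (a : R[i]) x y : IV j x -> IV j y -> IV j (a *: x + y).
Proof.
elim: j x y => [//|j IH] x y [x1 Ix Ex] [y1 Iy Ey].
by exists (a *: x1 + y1); [exact: IH | rewrite !linearP Ex Ey].
Qed.

Lemma IV0 j : IV j 0.
Proof. by elim: j => [//|j IH]; exists 0 => //; rewrite !linear0. Qed.

Lemma IVZ j (a : R[i]) x : IV j x -> IV j (a *: x).
Proof. by move=> Ix; rewrite -[_ *: _]addr0; apply: IV_linear => //; exact: IV0. Qed.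

Lemma IVN j x : IV j x -> IV j (- x).
Proof. by rewrite -scaleN1r; exact: IVZ. Qed.

Lemma IVB j x y : IV j x -> IV j y -> IV j (x - y).
Proof. by move=> Ix Iy; rewrite addrC -scaleN1r; exact: IV_linear. Qed.

Lemma IV_closed j : bounded_op A -> (forall i, closed (E @` IV i)) -> closed (IV j).
Proof.
move=> bdA clE; case: j => [|j]; first exact: closedT.
have cA : continuous A by move=> x; exact: bounded_op_cvg bdA (cvg_id).
exact: (continuous_closedP A).1 cA _ (clE j).
Qed.

(** The equation turns [u'(t)] in [IV_j] into [u(t)] in [IV_{j+1}], and closedness
    turns [u(t)] in [IV_j] for all [t] into [u'(t)] in [IV_j]. *)
Lemma solution_IV (bdA : bounded_op A) (clE : forall i, closed (E @` IV i))
    (u0 : H) (u : R -> H) : solution E A u0 u -> forall j, IV j u0.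
Proof.
move=> [u' [C1 cu0 eq]] j.
have IVu i t : 0 < t -> IV i (u t).
  elim: i t => [//|i IH] t t0.
  have [du _] := C1 t t0.
  exists (- u' t); last by rewrite linearN; apply/esym/eqP; rewrite -addr_eq0 addrC eq.
  apply: IVN.
  apply: (closed_cvg _ (IV_closed bdA clE) _ _ du).
  near=> h; apply: IVZ; apply: IVB; apply: IH => //.
  rewrite -ltrBlDl sub0r ltrNl; apply: le_lt_trans (ler_norm _) _.
  by rewrite normrN; near: h; exact: dnbhs0_lt.
apply: (closed_cvg _ (IV_closed bdA clE) _ _ cu0).
by near=> t; apply: IVu; near: t; exact: nbhs_right_gt.
Unshelve. all: by end_near.
Qed.

End InitialValueSpaces.

(** * Resolvents of polynomial growth *)

(** Throughout, [S n] is the resolvent at the real point [s n], which tends to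
    infinity with [n], and grows at most like [(s n) ^ k]. *)
Section ResolventSequence.
Context {R : realType} {H : hilbertType R} (E A : {linear H -> H}).
Context (s : nat -> R) (S : nat -> H -> H) (k : nat) (C : R).
Context (bdE : bounded_op E) (bdA : bounded_op A)
  (clE : forall j, closed (E @` IV E A j)).
Context (s_ge : forall n, n.+1%:R <= s n)
  (inv : forall n, bounded_inverse (pencil E A (s n)%:C) (S n))
  (growth : forall n y, rnorm (S n y) <= C * s n ^+ k * rnorm y).

Local Notation IV := (IV E A).

Let s_gt0 n : 0 < s n. Proof. by rewrite (lt_le_trans _ (s_ge n)). Qed.

Let s_ge1 n : 1 <= s n. Proof. by rewrite (le_trans _ (s_ge n))// ler1n. Qed.

Let linS n : linear (S n). Proof. by case: (inv n). Qed.

Lemma resolvent_seqA n x : S n (A x) = x - (s n)%:C *: S n (E x).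
Proof.
have [_ _ SP _] := inv n.
rewrite -{2}[x](SP x) /pencil linear_funD// linear_funZ//.
by rewrite addrC addKr.
Qed.

(** Both sides equal [E x - s E R(s)Ex]. *)
Lemma resolvent_seq_comm n x : A (S n (E x)) = E (S n (A x)).
Proof.
have [_ _ _ PS] := inv n.
rewrite resolvent_seqA linearB linearZ /=; apply/eqP; rewrite eq_sym subr_eq.
by rewrite addrC; apply/eqP/esym; exact: PS.
Qed.

Lemma IV_resolvent_seq n j x : IV j x -> IV j.+1 (S n (E x)).
Proof.
elim: j x => [|j IH] x Ix; rewrite /= resolvent_seq_comm; first by exists (S n (A x)).
by case: Ix => x1 Ix1 <-; exists (S n (E x1)) => //; exact: IH.
Qed.

(** If [A x = E x1] with [x1] in [IV j], then [s R(s)Ax = x1 - R(s)A x1], which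
    reduces the claim for [x] to that for [x1].  The term [x1] contributes [s^j],
    and is absorbed as long as [j <= k]. *)
Lemma IV_resolvent_growth j x : (j <= k.+1)%N -> IV j x ->
  exists D : R, forall n, s n ^+ j * rnorm (S n (A x)) <= D * s n ^+ k.
Proof.
elim: j x => [|j IH] x jk.
  move=> _; exists (C * rnorm (A x)) => n.
  by rewrite mul1r mulrAC.
move=> [x1 Ix1 Ex1]; have [D HD] := IH _ (ltnW jk) Ix1.
exists (rnorm x1 + D) => n.
have -> : s n ^+ j.+1 * rnorm (S n (A x)) = s n ^+ j * rnorm (x1 - S n (A x1)).
  rewrite -Ex1 resolvent_seqA opprB addrC subrK rnormZ gtr0_norm//.
  by rewrite exprSr mulrA.
have sj0 : 0 <= s n ^+ j by rewrite exprn_ge0// ltW.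
rewrite (le_trans (ler_wpM2l sj0 (ler_rnormB _ _)))//.
rewrite mulrDr mulrDl lerD// mulrC ler_wpM2l ?rnorm_ge0//.
by rewrite ler_weXn2l.
Qed.

Lemma IVk_bounded x : IV k x -> exists D : R, forall n, rnorm (S n (A x)) <= D.
Proof.
move=> /(IV_resolvent_growth (leqnSn k))[D HD]; exists D => n.
by have := HD n; rewrite mulrC ler_pM2r// exprn_gt0.
Qed.

Lemma IVk1_vanish x : IV k.+1 x ->
  exists D : R, forall n, rnorm (S n (A x)) <= D / s n.
Proof.
move=> /(IV_resolvent_growth (leqnn _))[D HD]; exists D => n.
rewrite ler_pdivlMr//; have := HD n.
by rewrite exprS mulrAC ler_pM2r ?exprn_gt0// mulrC.
Qed.

Lemma cvg_rnorm_inv (f : nat -> H) (y : H) (D : R) :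
  (forall n, rnorm (y - f n) <= D / s n) -> f @ \oo --> y.
Proof.
move=> fD; apply/cvg_rnormP => e e0.
exists (Num.truncn (D / e)) => // n /= nN.
rewrite (le_lt_trans (fD n))// ltr_pdivrMr// mulrC -ltr_pdivrMr//.
apply: lt_le_trans (s_ge n).
by rewrite (lt_le_trans (truncnS_gt _))// ler_nat ltnS.
Qed.

(** [E x] is the limit of the vectors [E (s R(s)Ex)], because the difference is
    [A R(s)Ex] and [R(s)Ex = (x - R(s)Ax) / s] tends to [0]. *)
Lemma image_IV_stable x : IV k x -> (E @` IV k.+1) (E x).
Proof.
move=> Ix; have [M M0 AM] := bounded_op_pos bdA.
have [D HD] := IVk_bounded Ix.
pose f n := (s n)%:C *: S n (E x).
have If n : (E @` IV k.+1) (E (f n)) by exists (f n) => //; apply/IVZ/IV_resolvent_seq.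
suff cf : E (f n) @[n --> \oo] --> E x.
  by apply: (closed_cvg _ (@clE k.+1) _ _ cf); exact: nearW.
apply: (@cvg_rnorm_inv _ _ (M * (rnorm x + D))) => n; rewrite /f.
have -> : E x - E ((s n)%:C *: S n (E x)) = A (S n (E x)).
  by rewrite resolvent_seq_comm resolvent_seqA linearB.
rewrite (le_trans (AM _))// -mulrA ler_pM2l// ler_pdivlMr// mulrC.
rewrite -[X in X * _]gtr0_norm// -rnormZ.
have -> : (s n)%:C *: S n (E x) = x - S n (A x) by rewrite resolvent_seqA opprB addrC subrK.
by rewrite (le_trans (ler_rnormB _ _))// lerD2l.
Qed.

(** On [IV_{k+1}] the operators [s R(s)E] tend pointwise to the identity; the
    uniform bound of [s R(s)] on [E[IV_{k+1}]] passes to the limit. *)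
Lemma E_bounded_below :
  exists c : R, forall x, IV k.+1 x -> rnorm x <= c * rnorm (E x).
Proof.
pose T n y := (s n)%:C *: S n y.
have linT n : linear (T n).
  by move=> a y z; rewrite /T linS scalerDr !scalerA mulrC.
have [c Tc] : exists c : R, forall n y, (E @` IV k.+1) y -> rnorm (T n y) <= c * rnorm y.
  apply: uniform_boundedness => //.
  - by exists 0; rewrite ?linear0//; exact: IV0.
  - move=> a _ _ [x Ix <-] [y Iy <-]; exists (a *: x + y); last by rewrite linearP.
    exact: IV_linear.
  - move=> n; exists (s n * (C * s n ^+ k)) => y.
    by rewrite rnormZ gtr0_norm// -mulrA ler_pM2l.
  move=> _ [x Ix <-]; have [D HD] := IVk1_vanish Ix.
  exists (rnorm x + `|D|) => n.
  have -> : T n (E x) = x - S n (A x) by rewrite resolvent_seqA opprB addrC subrK.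
  rewrite (le_trans (ler_rnormB _ _))// lerD2l// (le_trans (HD n))//.
  rewrite ler_pdivrMr// (le_trans (ler_norm D))//.
  by rewrite -[leLHS]mulr1 ler_wpM2l.
exists c => x Ix; have [D HD] := IVk1_vanish Ix.
have cx : T n (E x) @[n --> \oo] --> x.
  by apply: (cvg_rnorm_inv (D := D)) => n; rewrite -resolvent_seqA.
rewrite -[x in leLHS]subr0; apply: cvg_rnorm_le cx _.
by apply: nearW => n; rewrite subr0; apply: Tc; exists x.
Qed.

(** [g] below chooses the values of [- E^-1 A] on [IV_{k+1}], and the exponential
    series of the iterates of [g] at [u0] is [exp (- t E^-1 A) u0]. *)
Lemma IVk1_solution u0 : IV k.+1 u0 -> exists u : R -> H, solution E A u0 u.
Proof.
move=> Iu0.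
have /choice[g Hg] (x : H) : exists y, IV k.+1 x -> IV k.+1 y /\ E y = - A x.
  have [Ix|nIx] := pselect (IV k.+1 x); last by exists 0.
  have [x1 Ix1 <-] := Ix; have [y Iy <-] := image_IV_stable Ix1.
  by exists (- y) => _; split; [exact: IVN | rewrite linearN].
pose v i := iter i g u0.
have Iv i : IV k.+1 (v i) by elim: i => //= i IH; have [] := Hg _ IH.
have Ev i : E (v i.+1) = - A (v i) by have [] := Hg _ (Iv i).
have [c Ec] := E_bounded_below.
have [a a0 Aa] := bounded_op_pos bdA.
have gv : geom_growth v (rnorm u0) (`|c| * a).
  split; rewrite ?rnorm_ge0 ?mulr_ge0 ?(ltW a0)//.
  elim=> [|i IH]; first by rewrite expr0 mulr1.
  rewrite (le_trans (Ec _ (Iv _)))// Ev rnormN.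
  rewrite (le_trans (ler_wpM2r (rnorm_ge0 _) (ler_norm c)))//.
  rewrite exprS mulrCA -mulrA ler_wpM2l// (le_trans (Aa _))//.
  by rewrite ler_pM2l.
have gv1 := geom_growth_shift gv.
exists (expsum v), (expsum (v \o Datatypes.S)); split.
- move=> t _; split.
    by have [K] := expsum_taylor2 t gv; exact: taylor2_has_derivative.
  by have [K] := expsum_taylor2 t gv1; exact: taylor2_continuous.
- have [K HK] := expsum_taylor2 0 gv.
  rewrite -[u0]/(v 0%N) -expsum0; apply: cvg_at_right_filter.
  exact: taylor2_continuous HK.
- move=> t _.
  have cEA : E (expseries (v \o Datatypes.S) t n) + A (expseries v t n) @[n --> \oo] -->
      E (expsum (v \o Datatypes.S) t) + A (expsum v t).
    by apply: cvgD; apply: bounded_op_cvg => //; [exact: expseries_cvg gv1|exact: expseries_cvg gv].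
  rewrite -(cvg_lim _ cEA)//; apply/cvg_lim => //.
  apply: cvg_near_cst; apply: nearW => n.
  rewrite /= !linear_sum -big_split big1//= => i _.
  by rewrite !linearZ /= Ev scalerN addNr.
Qed.

End ResolventSequence.

(** [ind] is a default value unless its defining set has an element; here the least
    admissible exponent is one. *)
Lemma ind_resolvent_bound {R : realType} {H : hilbertType R} (E A : H -> H) nu0 :
  (exists k, resolvent_bound E A nu0 k) -> resolvent_bound E A nu0 (ind E A nu0).
Proof.
move=> [k bk].
have ex : exists k, `[< resolvent_bound E A nu0 k >] by exists k; apply/asboolP.
pose Q := [set k | resolvent_bound E A nu0 k /\
                    forall j, resolvent_bound E A nu0 j -> (k <= j)%N].
suff /(xgetPex 0%N)[] : exists k, Q k by [].
case: (ex_minnP ex) => m /asboolP bm mP; exists m; split => // j /asboolP; exact: mP.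
Qed.

(** * Consistent initial values *)

Theorem corollary1p4 (R : realType) (H : hilbertType R)
    (E A : {linear H -> H}) (bdE : bounded_op E) (bdA : bounded_op A)
    (nu0 : R) (regEA : regular_at E A nu0)
    (closedIV : forall j : nat, closed (E @` IV E A j))
    (u0 : H) :
  (exists u : R -> H, solution E A u0 u) <-> IV E A (ind E A nu0).+1 u0.
Proof.
split=> [[u /solution_IV]|]; first exact.
have [rhoP /ind_resolvent_bound[C _ bC]] := regEA.
(* The points [s n] lie in the half plane and satisfy [n + 1 <= s n]. *)
pose s n : R := (n + (Num.truncn `|nu0|).+1)%:R.
have s_nu n : nu0 < complex.Re (s n)%:C.
  apply: le_lt_trans (ler_norm _) _; rewrite (lt_le_trans (truncnS_gt _))//=.
  by rewrite ler_nat leq_addl.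
have inv n : bounded_inverse (pencil E A (s n)%:C) (resolvent E A (s n)%:C).
  exact: xgetPex (rhoP _ (s_nu n)).
apply: (IVk1_solution (s := s) bdE bdA closedIV _ inv) => [n|n y].
  by rewrite ler_nat addnS ltnS leq_addr.
have [linS bdS _ _] := inv n.
rewrite (le_trans (rnorm_opnorm y linS bdS))// ler_wpM2r ?rnorm_ge0//.
rewrite (le_trans (bC _ (s_nu n)))//.
have -> : rnorm (s n)%:C = s n :> R; last by [].
by rewrite /rnorm normc_def /= expr0n addr0 sqrtr_sqr ger0_norm ?ler0n.
Qed.
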